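(* Let $G$ be a walk-regular and strongly co-edge-regular graph with parameters $(n,k,2,k-2)$. If $G$ contains an induced quadrangle (induced $4$-cycle), then $G$ is isomorphic to the Shrikhande graph or to a $p\times q$-grid with $p+q=k+2$.
   Context: All graphs are finite, undirected and simple. A co-edge-regular graph with parameters $(n,k,c)$ is a $k$-regular graph on $n$ vertices, neither complete nor edgeless, in which any two distinct non-adjacent vertices have exactly $c$ common neighbours. For adjacent $x,y$, $a_{xy}$ is the number of common neighbours of $x,y$. A strongly co-edge-regular graph with parameters $(n,k,c,\ell)$ is a co-edge-regular graph with parameters $(n,k,c)$ such that for any two distinct non-adjacent vertices $x,z$, $\sum_{y\sim x,\,y\sim z}a_{xy}=\ell$. A graph with adjacency matrix $A$ is walk-regular if for every $r\geqslant0$ all diagonal entries of $A^r$ are equal. The $p\times q$-grid is $K_p\,\square\,K_q$. The Shrikhande graph is the Cayley graph on $\mathbb{Z}_4\times\mathbb{Z}_4$ with connection set $\{\pm(1,0),\pm(0,1),\pm(1,1)\}$. *)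

(* Defs.v *)
From mathcomp Require Import all_boot all_order all_algebra.
Set Implicit Arguments.
Unset Strict Implicit.
Unset Printing Implicit Defensive.
Import GRing.Theory.
Local Open Scope nat_scope.

Definition simple_graph (T : finType) (e : rel T) : Prop :=
  symmetric e /\ irreflexive e.

Definition graph_iso (T U : finType) (e : rel T) (f : rel U) : Prop :=
  exists2 h : T -> U, bijective h & forall x y, f (h x) (h y) = e x y.

Definition common_nbrs (T : finType) (e : rel T) (x y : T) : {set T} :=
  [set z | e x z && e y z].

Definition regular_graph (T : finType) (e : rel T) (k : nat) : Prop :=
  forall x, #|[set y | e x y]| = k.

Definition complete_graph (T : finType) (e : rel T) : Prop :=
  forall x y, x != y -> e x y.

Definition edgeless_graph (T : finType) (e : rel T) : Prop :=
  forall x y, ~~ e x y.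

Definition co_edge_regular (T : finType) (e : rel T) (n k c : nat) : Prop :=
  [/\ #|T| = n, regular_graph e k, ~ complete_graph e, ~ edgeless_graph e
    & forall x y, x != y -> ~~ e x y -> #|common_nbrs e x y| = c].

Definition strongly_co_edge_regular
    (T : finType) (e : rel T) (n k c l : nat) : Prop :=
  co_edge_regular e n k c /\
  forall x z, x != z -> ~~ e x z ->
    \sum_(y in common_nbrs e x z) #|common_nbrs e x y| = l.

Definition adjacency (T : finType) (e : rel T) : 'M[int]_#|T| :=
  (\matrix_(i, j) (e (enum_val i) (enum_val j))%:R)%R.

Definition walk_regular (T : finType) (e : rel T) : Prop :=
  forall (r : nat) (i j : 'I_#|T|),
    (adjacency e ^+ r)%R i i = (adjacency e ^+ r)%R j j.

Definition has_induced_quadrangle (T : finType) (e : rel T) : Prop :=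
  exists x0 x1 x2 x3 : T,
    [/\ uniq [:: x0; x1; x2; x3],
        [/\ e x0 x1, e x1 x2, e x2 x3 & e x3 x0],
        ~~ e x0 x2 & ~~ e x1 x3].

Definition complete_rel (T : finType) : rel T := [rel x y | x != y].

Definition cartesian_product (T U : finType) (e : rel T) (f : rel U) :
    rel (T * U)%type :=
  [rel x y | (x.1 == y.1) && f x.2 y.2 || e x.1 y.1 && (x.2 == y.2)].

Definition grid (p q : nat) : rel ('I_p * 'I_q)%type :=
  cartesian_product (@complete_rel 'I_p) (@complete_rel 'I_q).

Definition shrikhande_set : seq ('Z_4 * 'Z_4)%type :=
  [:: (1, 0); - (1, 0); (0, 1); - (0, 1); (1, 1); - (1, 1)]%R.

Definition shrikhande : rel ('Z_4 * 'Z_4)%type :=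
  [rel x y | (y - x)%R \in shrikhande_set].

(* Main.v *)
(** Write [D(x)] for the subgraph induced on the neighbours of [x].  Two
    non-adjacent vertices of [D(x)] have at most one common neighbour in [D(x)].
    If they have none, they form with [x] three corners of an induced
    quadrangle, their degrees in [D(x)] add up to [k - 2], and hence their closed
    neighbourhoods partition [D(x)].  Any vertex of [D(x)] that is not adjacent
    to all others has a partner in [D(x)] whose degree is complementary in the
    sum [k - 2]; comparing degrees leaves only two shapes for a [D(x)] that
    contains such a pair: a disjoint union of two cliques, or a hexagon.  The
    shape is inherited by the neighbours of [x], so by connectedness it is the
    same at every vertex.  Two cliques everywhere give a grid, coordinatised by
    projection onto the two maximal cliques through a vertex.  Hexagons
    everywhere determine all adjacencies from a single wheel, and the result is
    the Shrikhande graph. *)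

Require Import Defs.
From mathcomp Require Import all_boot all_order all_algebra.
From mathcomp Require Import zify.

Set Implicit Arguments.
Unset Strict Implicit.
Unset Printing Implicit Defensive.

Import GRing.Theory.

Local Open Scope nat_scope.

Lemma inj_surj_bij (A : finType) (B : eqType) (f : A -> B) :
  injective f -> (forall b, exists a, f a == b) -> bijective f.
Proof.
move=> f_inj f_surj; exists (fun b => xchoose (f_surj b)) => [a|b].
  by apply/f_inj/eqP; apply: (xchooseP (f_surj (f a))).
by apply/eqP; apply: (xchooseP (f_surj b)).
Qed.

(** * Wheel coordinates on the Shrikhande graph *)

(* The sixteen vertices as seen from a wheel with hub [x] and rim [H 0 .. H 5]:
   [Tip i] is the second common neighbour of [H i] and [H (i + 1)], [Pole i] that
   of [H i] and [H (i + 3)], so that [Pole (i + 3)] and [Pole i] denote the same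
   vertex. *)
Inductive spot : Type :=
  | Hub | Rim of 'Z_6 | Tip of 'Z_6 | Pole of 'Z_6.

Definition spot_adj (c d : spot) : bool :=
  match c, d with
  | Hub, Rim _ | Rim _, Hub => true
  | Rim i, Rim j => (j == i + 1)%R || (i == j + 1)%R
  | Rim i, Tip j | Tip j, Rim i => (i == j) || (i == j + 1)%R
  | Rim i, Pole j | Pole j, Rim i => (i == j) || (i == j + 3)%R
  | Tip j, Pole i | Pole i, Tip j =>
      [|| j == i, j == i - 1, j == i + 3 | j == i + 2]%R
  | Tip i, Tip j => (j == i + 2)%R || (i == j + 2)%R
  | _, _ => false
  end.

(** A fingerprint: adjacency to the hub, then to each rim vertex. It separates the sixteen vertices
    yet agrees on the two names of a pole, so it can stand in for equality of vertices. *)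
Definition spot_sig (c : spot) : seq bool :=
  (if c is Rim _ then true else false) ::
  [seq spot_adj (Rim i) c | i <- [:: 0; 1; 2; 3; 4; 5]%R].

(* The rim is [(1,0), (1,1), (0,1), (3,0), (3,3), (0,3)] in cyclic order; [Tip i]
   sits at the sum of rim vertices [i] and [i + 1], [Pole i] at twice rim
   vertex [i]. *)
Definition spot_of (a : 'Z_4 * 'Z_4) : spot :=
  nth Hub
    [:: Hub;      Rim 2%R; Pole 2%R; Rim 5%R;
        Rim 0%R;  Rim 1%R; Tip 1%R;  Tip 5%R;
        Pole 0%R; Tip 0%R; Pole 1%R; Tip 3%R;
        Rim 3%R;  Tip 2%R; Tip 4%R;  Rim 4%R] (a.1 * 4 + a.2).

(** One direction suffices: an injective homomorphism between 6-regular graphs also reflects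
    adjacency. *)
Lemma spot_of_adj a b : shrikhande a b -> spot_adj (spot_of a) (spot_of b).
Proof.
case: a b => [a1 a2] [b1 b2].
by case: a1 => -[|[|[|[|//]]]] ?; case: a2 => -[|[|[|[|//]]]] ?;
  case: b1 => -[|[|[|[|//]]]] ?; case: b2 => -[|[|[|[|//]]]] ?.
Qed.

Lemma spot_sig_inj a b : spot_sig (spot_of a) = spot_sig (spot_of b) -> a = b.
Proof.
case: a b => [a1 a2] [b1 b2].
by case: a1 => -[|[|[|[|//]]]] ?; case: a2 => -[|[|[|[|//]]]] ?;
  case: b1 => -[|[|[|[|//]]]] ?; case: b2 => -[|[|[|[|//]]]] ? //= _;
  congr (_, _); apply/val_inj.
Qed.

Lemma spot_of_rim i : exists a, spot_of a = Rim i.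
Proof.
case: i => -[|[|[|[|[|[|//]]]]]] ?.
- by exists (1, 0)%R; congr Rim; apply/val_inj.
- by exists (1, 1)%R; congr Rim; apply/val_inj.
- by exists (0, 1)%R; congr Rim; apply/val_inj.
- by exists (3, 0)%R; congr Rim; apply/val_inj.
- by exists (3, 3)%R; congr Rim; apply/val_inj.
- by exists (0, 3)%R; congr Rim; apply/val_inj.
Qed.

Lemma spot_of_tip i : exists a, spot_of a = Tip i.
Proof.
case: i => -[|[|[|[|[|[|//]]]]]] ?.
- by exists (2, 1)%R; congr Tip; apply/val_inj.
- by exists (1, 2)%R; congr Tip; apply/val_inj.
- by exists (3, 1)%R; congr Tip; apply/val_inj.
- by exists (2, 3)%R; congr Tip; apply/val_inj.
- by exists (3, 2)%R; congr Tip; apply/val_inj.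
- by exists (1, 3)%R; congr Tip; apply/val_inj.
Qed.

(** [spot_of] uses only the names [Pole 0], [Pole 1] and [Pole 2], hence the second alternative. *)
Lemma spot_of_pole i :
  exists a, spot_of a = Pole i \/ spot_of a = Pole (i + 3)%R.
Proof.
case: i => -[|[|[|[|[|[|//]]]]]] ?.
- by exists (2, 0)%R; left; congr Pole; apply/val_inj.
- by exists (2, 2)%R; left; congr Pole; apply/val_inj.
- by exists (0, 2)%R; left; congr Pole; apply/val_inj.
- by exists (2, 0)%R; right; congr Pole; apply/val_inj.
- by exists (2, 2)%R; right; congr Pole; apply/val_inj.
- by exists (0, 2)%R; right; congr Pole; apply/val_inj.
Qed.

Lemma shrikhande_degree a : #|[set b | shrikhande a b]| = 6.
Proof.
have -> : [set b | shrikhande a b] =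
    (fun s : 'Z_4 * 'Z_4 => (s + a)%R) @: [set s in shrikhande_set].
  apply/setP=> b; rewrite inE; apply/idP/imsetP => [ab|[s]].
    by exists (b - a)%R; rewrite ?subrK // inE.
  by rewrite inE => sS ->; rewrite /shrikhande /= addrK.
rewrite card_imset; last exact: addIr.
by rewrite cardsE; apply/(@card_uniqP _ shrikhande_set).
Qed.

(** * Common neighbours and local degrees *)

Section Local.

Variables (T : finType) (e : rel T) (k : nat).
Hypotheses (e_sym : symmetric e) (e_irr : irreflexive e).
Hypothesis e_reg : regular_graph e k.
Hypothesis two_common :
  forall x y, x != y -> ~~ e x y -> #|common_nbrs e x y| = 2.
Hypothesis sum_common : forall x z, x != z -> ~~ e x z ->
  \sum_(y in common_nbrs e x z) #|common_nbrs e x y| = k - 2.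

Local Notation C := (common_nbrs e).
Implicit Types x y z u v w : T.

Lemma in_common x y z : (z \in C x y) = e x z && e y z.
Proof. by rewrite inE. Qed.

Lemma edge_neq x y : e x y -> x != y.
Proof. by apply: contraTneq => ->; rewrite e_irr. Qed.

Lemma nonadj_neq x y z : e x y -> ~~ e x z -> y != z.
Proof. by move=> xy; apply: contraNneq => <-. Qed.

(** The sum over the common neighbours of a non-adjacent pair has just two terms, so one common
    neighbour [y] determines the other one and its degree in [D(x)]. *)
Lemma common_other x z y : x != z -> ~~ e x z -> e x y -> e z y ->
  exists y', [/\ y' != y, e x y', e z y',
    forall w, e x w -> e z w -> w = y \/ w = y'
    & #|C x y| + #|C x y'| = k - 2].
Proof.
move=> xz nxz xy zy; have := sum_common xz nxz.
have /eqP/cards2P[p [q [pq Cpq]]] := two_common xz nxz.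
have inC w : e x w && e z w = (w == p) || (w == q).
  by rewrite -in_common Cpq !inE.
rewrite Cpq big_setU1 ?inE //= big_set1 => sumk.
have /orP[/eqP yp|/eqP yq] : (y == p) || (y == q) by rewrite -inC xy.
- have /andP[xq zq] : e x q && e z q by rewrite inC eqxx orbT.
  exists q; split; rewrite ?yp // 1?eq_sym // => w xw zw.
  have /orP[/eqP->|/eqP->] : (w == p) || (w == q) by rewrite -inC xw.
    by left.
  by right.
- have /andP[xp zp] : e x p && e z p by rewrite inC eqxx.
  exists p; split; rewrite ?yq // 1?addnC // => w xw zw.
  have /orP[/eqP->|/eqP->] : (w == p) || (w == q) by rewrite -inC xw.
    by right.
  by left.
Qed.

Lemma common_three x z a b c : x != z -> ~~ e x z -> e x a -> e z a ->
  e x b -> e z b -> e x c -> e z c -> a != b -> a != c -> b = c.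
Proof.
move=> xz nxz xa za xb zb xc zc ab ac.
have [y [ya _ _ only _]] := common_other xz nxz xa za.
have [ba|->] := only b xb zb; first by rewrite ba eqxx in ab.
by have [ca|->] := only c xc zc; first by rewrite ca eqxx in ac.
Qed.

(** [x] is already one of the two common neighbours of [u] and [v], which leaves room for only one
    in [D(x)]. *)
Lemma common_local x u v w1 w2 : e x u -> e x v -> u != v -> ~~ e u v ->
  e x w1 -> e x w2 -> e u w1 -> e v w1 -> e u w2 -> e v w2 -> w1 = w2.
Proof.
move=> xu xv uv nuv xw1 xw2 uw1 vw1 uw2 vw2.
by apply: (common_three (a := x) uv nuv); rewrite ?edge_neq // e_sym.
Qed.

(** Otherwise the neighbours of [u] are confined to [x] and the neighbours of [x] other than [u] and
    [w], only [k - 1] vertices. *)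
Lemma outside_nbr x u w : e x u -> e x w -> w != u -> ~~ e u w ->
  exists z, [/\ x != z, ~~ e x z & e u z].
Proof.
move=> xu xw wu nuw.
have [/existsP[z /and3P[]]|] := boolP [exists z, [&& x != z, ~~ e x z & e u z]].
  by exists z.
rewrite negb_exists => /forallP h.
have sub : [set z | e u z] \subset x |: ([set z | e x z] :\ u :\ w).
  apply/subsetP=> z; rewrite !inE => uz.
  have := h z; rewrite uz andbT negb_and !negbK eq_sym => /orP[->//|->].
  by rewrite (nonadj_neq uz nuw) [z == u]eq_sym (edge_neq uz) orbT.
have := subset_leq_card sub; rewrite e_reg cardsU1.
have := cardsD1 u [set z | e x z]; have := cardsD1 w ([set z | e x z] :\ u).
by rewrite e_reg !inE xu xw wu; clear; lia.
Qed.

Lemma partner x u z : x != z -> ~~ e x z -> e x u -> e u z ->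
  exists p, [/\ e x p, e z p, p != u & #|C x u| + #|C x p| = k - 2].
Proof.
move=> xz nxz xu uz; rewrite e_sym in uz.
by have [p [? ? ? ? ?]] := common_other xz nxz xu uz; exists p.
Qed.

(** * Zero pairs *)

Definition zero_pair x y y' : Prop :=
  [/\ e x y, e x y', y != y', ~~ e y y'
    & forall w, e x w -> e y w -> e y' w -> False].

Lemma zero_pair_sym x y y' : zero_pair x y y' -> zero_pair x y' y.
Proof.
case=> ? ? ? ? h; split; rewrite // 1?eq_sym 1?e_sym // => w ? ? ?.
exact: (h w).
Qed.

(** The second common neighbour [z] of [y] and [y'] is not adjacent to [x], so [y] and [y'] are
    exactly the two common neighbours of [x] and [z]. *)
Lemma zero_pair_sum x y y' :
  zero_pair x y y' -> #|C x y| + #|C x y'| = k - 2.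
Proof.
case=> xy xy' yy' nyy' zero.
have yx : e y x by rewrite e_sym.
have y'x : e y' x by rewrite e_sym.
have [z [zx yz y'z _ _]] := common_other yy' nyy' yx y'x.
have nxz : ~~ e x z by apply/negP => xz; exact: (zero z).
rewrite eq_sym in zx; rewrite e_sym in yz; rewrite e_sym in y'z.
have [p [py xp zp only <-]] := common_other zx nxz xy yz.
by have [y'y|->//] := only y' xy' y'z; rewrite y'y eqxx in yy'.
Qed.

(** The closed neighbourhoods of [y] and [y'] in [D(x)] are disjoint, and by [zero_pair_sum] they
    have [k] vertices in total, which exhausts the neighbours of [x]. *)
Lemma zero_pair_cover x y y' w : zero_pair x y y' -> e x w ->
  [\/ w = y, w = y', w \in C x y | w \in C x y'].
Proof.
move=> zp; have sumk := zero_pair_sum zp.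
case: zp => xy xy' yy' nyy' zero xw.
have dis : [disjoint C x y & C x y'].
  rewrite -setI_eq0; apply/eqP/setP=> s; rewrite !inE.
  by apply/negbTE/negP=> /andP[/andP[xs ys] /andP[_ y's]]; apply: (zero s).
pose A := y |: (y' |: (C x y :|: C x y')).
have sub : A \subset [set s | e x s].
  apply/subsetP=> s; rewrite !inE.
  by case/or4P=> [/eqP->|/eqP->|/andP[]|/andP[]].
have cA : #|A| = k.
  (* The subtraction in [k - 2] is truncated, so this is required before the 2 can be added back. *)
  have card2 : 2 <= k.
    rewrite -(e_reg x) (leq_trans _ (subset_leq_card (_ : [set y; y'] \subset _))) //.
      by rewrite cards2 yy'.
    by apply/subsetP=> s; rewrite !inE => /orP[/eqP->|/eqP->].
  rewrite !cardsU1 !inE !e_irr !andbF (negPf yy') [e y' y]e_sym (negPf nyy').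
  by rewrite !andbF /= cardsU disjoint_setI0 // cards0; move: sumk card2; clear; lia.
have /eqP eqA : A == [set s | e x s] by rewrite eqEcard sub cA e_reg leqnn.
have : w \in A by rewrite eqA inE.
rewrite !in_setU !in_set1.
case/or4P=> [/eqP->|/eqP->|->|->]; by [apply: Or41|apply: Or42|apply: Or43|apply: Or44].
Qed.

(** * Cliques and edges across a zero pair *)

Definition clique (A : {set T}) := [forall s in A, forall t in A, (s != t) ==> e s t].

Lemma cliqueP (A : {set T}) :
  reflect {in A &, forall s t, s != t -> e s t} (clique A).
Proof.
apply: (iffP forall_inP) => [h s t sA tA st|h s sA].
  by have /forall_inP/(_ t tA)/implyP := h s sA; apply.
by apply/forall_inP => t tA; apply/implyP; apply: h.
Qed.

Lemma cliquePn (A : {set T}) : ~~ clique A ->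
  exists s t, [/\ s \in A, t \in A, s != t & ~~ e s t].
Proof.
rewrite negb_forall => /existsP[s]; rewrite negb_imply => /andP[sA].
rewrite negb_forall => /existsP[t]; rewrite !negb_imply.
by case/and3P=> tA st nst; exists s, t.
Qed.

(* Otherwise [(u, y')] is a zero pair too, so [u] is adjacent to the rest of
   [C x y], and two non-adjacent members of [C x y] share both [u] and [y]. *)
Lemma nonclique_cross x y y' u : zero_pair x y y' -> ~~ clique (C x y) ->
  u \in C x y -> exists v, v \in C x y' /\ e u v.
Proof.
move=> zp /cliquePn[s [t]]; rewrite !in_common.
move=> [/andP[xs ys] /andP[xt yt] st nst] /andP[xu yu].
have [/existsP[v /andP[? ?]]|] := boolP [exists v, (v \in C x y') && e u v].
  by exists v.
rewrite negb_exists => /forallP none.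
case: (zp) => xy xy' yy' nyy' zero.
have nuy' : ~~ e u y' by apply/negP=> uy'; apply: (zero u); rewrite // e_sym.
have zpu : zero_pair x u y'.
  split=> //; first by apply: contraNneq nyy' => <-.
  by move=> w xw uw y'w; have := none w; rewrite in_common xw uw y'w.
have adj w : e x w -> e y w -> w != u -> e u w.
  move=> xw yw wu; case: (zero_pair_cover zpu xw) => [wu'|wy'||].
  - by rewrite wu' eqxx in wu.
  - by rewrite wy' (negPf nyy') in yw.
  - by rewrite in_common => /andP[].
  - by rewrite in_common => /andP[_ y'w]; case: (zero w).
have [su|su] := eqVneq s u.
  by rewrite su (adj t) // -su eq_sym in nst.
have [tu|tu] := eqVneq t u.
  by rewrite tu e_sym (adj s) // in nst.
have : y = u by apply: (common_local xs xt st nst); rewrite // e_sym ?adj.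
by move=> yu'; rewrite yu' e_irr in yu.
Qed.

(** [u] and [y'] are non-adjacent, so [common_local] allows them one common neighbour in [D(x)].
    Applied from both sides, this makes the edges between [C x y] and [C x y'] a matching. *)
Lemma cross_unique x y y' u v1 v2 : zero_pair x y y' -> u \in C x y ->
  v1 \in C x y' -> v2 \in C x y' -> e u v1 -> e u v2 -> v1 = v2.
Proof.
rewrite !in_common => -[xy xy' yy' nyy' zero] /andP[xu yu].
move=> /andP[xv1 y'v1] /andP[xv2 y'v2] uv1 uv2.
apply: (common_local xu xy') => //; first by apply: contraNneq nyy' => <-.
by apply/negP=> uy'; apply: (zero u); rewrite // e_sym.
Qed.

Lemma cross_nonadj x y y' u : zero_pair x y y' -> u \in C x y ->
  [/\ e x u, e y u, ~~ e y' u & u != y'].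
Proof.
rewrite in_common => -[xy xy' yy' nyy' zero] /andP[xu yu]; split=> //.
  by apply/negP=> y'u; apply: (zero u).
by apply: contraNneq nyy' => <-.
Qed.

Lemma clique_card_le x y w : e x y -> clique (C x y) -> w \in C x y ->
  #|C x y| <= #|C x w|.
Proof.
move=> xy /cliqueP cl wC; have /andP[xw yw] : e x w && e y w by rewrite -in_common.
have sub : y |: (C x y :\ w) \subset C x w.
  apply/subsetP=> s; rewrite in_setU1 in_setD1 => /orP[/eqP->|/andP[sw sC]].
    by rewrite in_common xy e_sym.
  have /andP[xs _] : e x s && e y s by rewrite -in_common.
  by rewrite in_common xs cl // eq_sym.
have := subset_leq_card sub; rewrite cardsU1 !inE e_irr !andbF.
by rewrite (cardsD1 w (C x y)) wC.
Qed.

Lemma clique_card_lt x y w v : e x y -> clique (C x y) -> w \in C x y ->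
  e x v -> e w v -> y != v -> ~~ e y v -> #|C x y| < #|C x w|.
Proof.
move=> xy /cliqueP cl wC xv wv yv nyv.
have /andP[xw yw] : e x w && e y w by rewrite -in_common.
have sub : v |: (y |: (C x y :\ w)) \subset C x w.
  apply/subsetP=> s; rewrite !in_setU1 in_setD1.
  case/or3P=> [/eqP->|/eqP->|/andP[sw sC]].
  - by rewrite in_common xv wv.
  - by rewrite in_common xy e_sym.
  have /andP[xs _] : e x s && e y s by rewrite -in_common.
  by rewrite in_common xs cl // eq_sym.
have := subset_leq_card sub; rewrite !cardsU1 !inE e_irr !andbF.
by rewrite [v == y]eq_sym (negPf yv) (negPf nyv) !andbF (cardsD1 w (C x y)) wC.
Qed.

(** The edge [uv] raises the degree of [u] in [D(x)] above that of [y], so the partner of [u] has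
    smaller degree than [y']. In a clique half no degree is below that of its centre, so the partner
    lies on the side of [y] and has at least the degree of [y]. *)
Lemma two_cliques_cross x y y' u v : zero_pair x y y' ->
  clique (C x y) -> clique (C x y') -> u \in C x y -> v \in C x y' ->
  e u v -> #|C x y| < #|C x y'|.
Proof.
move=> zp cl cl' uC vC uv; have sumk := zero_pair_sum zp.
have [xu yu ny'u uy'] := cross_nonadj zp uC.
have [xv y'v nyv vy] := cross_nonadj (zero_pair_sym zp) vC.
case: (zp) => xy xy' _ _ _.
have lt_u : #|C x y| < #|C x u|.
  by apply: (clique_card_lt (v := v)); rewrite // eq_sym.
have [||z [xz nxz uz]] := outside_nbr xu xy'; rewrite // 1?eq_sym 1?e_sym //.
have [p [xp _ _ sump]] := partner xz nxz xu uz.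
case: (zero_pair_cover zp xp) => [py|py'|pC|pC].
- by rewrite py in sump; move: sump sumk lt_u; clear; lia.
- by rewrite py' in sump; move: sump sumk lt_u; clear; lia.
- by have := clique_card_le xy cl pC; move: sump sumk lt_u; clear; lia.
- by have := clique_card_le xy' cl' pC; move: sump sumk lt_u; clear; lia.
Qed.

(** * The two local shapes *)

Definition bicliqual x : Prop := exists S : {set T},
  [/\ exists2 y, e x y & y \in S, exists2 y, e x y & y \notin S
    & forall u v, e x u -> e x v -> u != v ->
        e u v = ((u \in S) == (v \in S))].

Definition hexagonal x : Prop := exists H : 'Z_6 -> T,
  (forall y, e x y <-> exists i, y = H i) /\
  (forall i j, e (H i) (H j) = (j == i + 1)%R || (i == j + 1)%R).

Lemma two_cliques_bicliqual x y y' : zero_pair x y y' ->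
  clique (C x y) -> clique (C x y') -> bicliqual x.
Proof.
move=> zp cl cl'; case: (zp) => xy xy' yy' nyy' zero.
have zp' := zero_pair_sym zp.
(* An edge across would give strict inequalities between the two degrees in both directions. *)
have nocross u v : u \in C x y -> v \in C x y' -> e u v = false.
  move=> uC vC; apply/negP=> uv.
  have lt := two_cliques_cross zp cl cl' uC vC uv.
  rewrite e_sym in uv.
  by have := two_cliques_cross zp' cl' cl vC uC uv; rewrite ltnNge (ltnW lt).
have half z z' : zero_pair x z z' -> clique (C x z) ->
    (forall u v, u \in C x z -> v \in C x z' -> e u v = false) ->
    forall u v, e x u -> e x v -> u != v -> u \in z |: C x z ->
    e u v = (v \in z |: C x z).
  move=> zpz /cliqueP clz noc u v xu xv uv.
  rewrite !in_setU1 => /orP[/eqP uz|uC].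
    by rewrite in_common xv /= -uz eq_sym (negPf uv).
  have [_ zu nz'u uz'] := cross_nonadj zpz uC.
  case: (zero_pair_cover zpz xv) => [->|vz'|vC|vC].
  - by rewrite eqxx /= e_sym.
  - case: (zpz) => _ _ zz' nzz' _.
    by rewrite vz' in_common eq_sym (negPf zz') (negPf nzz') andbF e_sym (negPf nz'u).
  - by rewrite vC orbT clz.
  - have [_ _ nzv vz] := cross_nonadj (zero_pair_sym zpz) vC.
    by rewrite (negPf vz) in_common (negPf nzv) andbF noc.
have side' u : e x u -> u \notin y |: C x y -> u \in y' |: C x y'.
  move=> xu; rewrite !in_setU1 negb_or => /andP[uy uC].
  case: (zero_pair_cover zp xu) => [uy'|->|uC'|->]; rewrite ?eqxx ?orbT //.
    by rewrite uy' eqxx in uy.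
  by rewrite uC' in uC.
exists (y |: C x y); split; first by exists y; rewrite // in_setU1 eqxx.
  exists y' => //; rewrite in_setU1 in_common (negPf nyy') andbF orbF.
  by rewrite eq_sym.
move=> u v xu xv uv; have [uS|uS] := boolP (u \in y |: C x y).
  by rewrite (half y y').
have [vS|vS] := boolP (v \in y |: C x y).
  by rewrite e_sym (half y y') 1?eq_sym // (negPf uS).
rewrite (half y' y) ?side' // => u' v' ? ?.
by rewrite e_sym nocross.
Qed.

(** * Halves that are not cliques *)

Lemma cross_card_le x y y' : zero_pair x y y' -> ~~ clique (C x y) ->
  #|C x y| <= #|C x y'|.
Proof.
(* [phi] picks the cross neighbour supplied by [nonclique_cross]; the default [u] is never taken on
   [C x y]. *)
move=> zp ncl; pose phi u := odflt u [pick v | (v \in C x y') && e u v].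
have phiP u : u \in C x y -> phi u \in C x y' /\ e u (phi u).
  move=> uC; rewrite /phi; case: pickP => [v /andP[] //|none].
  have [v [vC uv]] := nonclique_cross zp ncl uC.
  by have := none v; rewrite vC uv.
have phi_inj : {in C x y &, injective phi}.
  move=> u1 u2 u1C u2C eq_phi; have [v1C uv1] := phiP _ u1C.
  have [_ uv2] := phiP _ u2C; rewrite -eq_phi in uv2.
  by apply: (cross_unique (zero_pair_sym zp) v1C) => //; rewrite e_sym.
rewrite -(card_in_imset phi_inj); apply/subset_leq_card/subsetP=> v.
by case/imsetP=> u uC ->; have [] := phiP u uC.
Qed.

(** If [u] were adjacent to both ends of a non-adjacent pair in [C x y], that pair would share [x],
    [y] and [u]. *)
Lemma nonclique_nonnbr x y u : e x y -> ~~ clique (C x y) -> u \in C x y ->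
  exists t, [/\ t \in C x y, t != u & ~~ e u t].
Proof.
move=> xy /cliquePn[s [t [sC tC st nst]]] uC.
have [su|su] := eqVneq s u; first by exists t; rewrite -su eq_sym.
have [tu|tu] := eqVneq t u; first by exists s; rewrite -tu e_sym.
have [us|] := boolP (e u s); last by exists s.
have [ut|] := boolP (e u t); last by exists t.
move: sC tC uC; rewrite !in_common.
move=> /andP[xs ys] /andP[xt yt] /andP[xu yu].
have yu' : y = u by apply: (common_local xs xt st nst); rewrite // e_sym.
by rewrite yu' e_irr in yu.
Qed.

(** The 2 accounts for [y] and for the single cross neighbour [v]. *)
Lemma cross_card x y y' u v : zero_pair x y y' -> u \in C x y ->
  v \in C x y' -> e u v -> #|C x u| <= #|[set w in C x y | e u w]| + 2.
Proof.
move=> zp uC vC uv.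
have sub : C x u \subset y |: (v |: [set w in C x y | e u w]).
  apply/subsetP=> w; rewrite in_common => /andP[xw uw].
  rewrite !in_setU1 inE uw andbT.
  case: (zero_pair_cover zp xw) => [->|wy'|->|wC]; rewrite ?eqxx ?orbT //.
    have [_ _ ny'u _] := cross_nonadj zp uC.
    by rewrite wy' e_sym (negPf ny'u) in uw.
  by rewrite (cross_unique zp uC vC wC uv uw) eqxx orbT.
apply: leq_trans (subset_leq_card sub) _; rewrite !cardsU1.
by case: (_ \notin _); case: (_ \notin _); clear; lia.
Qed.

(** The non-clique half turns out to be an independent set whose members have degree 2 in [D(x)].
    Every neighbour of [u] outside [D(x)] is then a neighbour of its cross neighbour [v], and
    together with the clique this gives [v] more than [k] neighbours. *)
Lemma nonclique_clique x y y' : zero_pair x y y' ->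
  ~~ clique (C x y) -> clique (C x y') -> False.
Proof.
move=> zp ncl cl'; have zp' := zero_pair_sym zp.
case: (zp) => xy xy' yy' nyy' zero; have sumk := zero_pair_sum zp.
have ab := cross_card_le zp ncl.
(* [C x y] has no inner edges: if [w] in [C x y] were adjacent to [u], then [u] and the cross
   neighbour [v2] of [w] would share [x], [w] and [v]. *)
have nbrs u v w : u \in C x y -> v \in C x y' -> e u v -> e x w -> e u w ->
    w = y \/ w = v.
  move=> uC vC uv xw uw; have [xu yu ny'u uy'] := cross_nonadj zp uC.
  have [xv y'v nyv vy] := cross_nonadj zp' vC.
  case: (zero_pair_cover zp xw) => [|wy'|wC|wC]; first by left.
  - by rewrite wy' e_sym (negPf ny'u) in uw.
  - have [v2 [v2C wv2]] := nonclique_cross zp ncl wC.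
    have [xv2 y'v2 nyv2 v2y] := cross_nonadj zp' v2C.
    have [_ yw ny'w wy'] := cross_nonadj zp wC.
    have [vv2|vv2] := eqVneq v v2.
      have uw' : u = w.
        by apply: (common_local xy xv); rewrite // 1?eq_sym // e_sym // vv2.
      by rewrite uw' e_irr in uw.
    have nuv2 : ~~ e u v2.
      by apply: contra vv2 => uv2; rewrite (cross_unique zp uC vC v2C).
    have wv : w = v.
      apply: (common_local xu xv2) => //; last 1 first.
      - by rewrite (cliqueP _ cl') // eq_sym.
      - by apply: contraNneq nyv2 => <-.
      by rewrite e_sym.
    by rewrite -wv yw in nyv.
  - by right; apply: (cross_unique zp uC).
have deg2 u : u \in C x y -> #|C x u| = 2.
  move=> uC; have [v [vC uv]] := nonclique_cross zp ncl uC.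
  have [xu yu _ _] := cross_nonadj zp uC.
  have [xv y'v nyv vy] := cross_nonadj zp' vC.
  have -> : C x u = [set y; v].
    apply/setP=> w; rewrite in_common in_set2; apply/andP/orP=> [[xw uw]|].
      by case: (nbrs u v w uC vC uv xw uw) => ->; [left | right].
    by case=> /eqP->; rewrite ?xy ?xv // e_sym.
  by rewrite cards2 eq_sym vy.
have [u [t [uC tC ut nut]]] := cliquePn ncl.
have [v [vC uv]] := nonclique_cross zp ncl uC.
have [xu yu ny'u uy'] := cross_nonadj zp uC.
have [xv y'v nyv vy] := cross_nonadj zp' vC.
have lt_v : #|C x y'| < #|C x v|.
  by apply: (clique_card_lt (v := u)); rewrite // 1?eq_sym // e_sym.
(* The degree of [v] exceeds [#|C x y'|], so its partner has degree below [#|C x y|]; only a member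
   of [C x y], of degree 2, qualifies. *)
have a3 : 2 < #|C x y|.
  have [||z [xz nxz vz]] := outside_nbr xv xy; rewrite // 1?eq_sym 1?e_sym //.
  have [p [xp _ _ sump]] := partner xz nxz xv vz.
  case: (zero_pair_cover zp xp) => [py|py'|pC|pC].
  - by rewrite py in sump; move: sump sumk lt_v ab; clear; lia.
  - by rewrite py' in sump; move: sump sumk lt_v ab; clear; lia.
  - by rewrite (deg2 p pC) in sump; move: sump sumk lt_v ab; clear; lia.
  - have := clique_card_le xy' cl' pC.
    by move: sump sumk lt_v ab; clear; lia.
(* A partner of [u] other than [y] and [v] would be non-adjacent to [u] and share with it [x], [z]
   and a vertex of [D(x)]; degrees exclude [y]. *)
have to_v z : x != z -> ~~ e x z -> e u z -> e v z.
  move=> xz nxz uz; have [p [xp zp_ pu sump]] := partner xz nxz xu uz.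
  suff pyv : p = y \/ p = v.
    rewrite (deg2 u uC) in sump; case: pyv => pE; rewrite pE in sump zp_.
      by move: sump sumk a3 ab; clear; lia.
    by rewrite e_sym.
  have [up|nup] := boolP (e u p); first exact: (nbrs u v p).
  have three q : e x q -> e u q -> e p q -> False.
    move=> xq uq pq; have xu' : e u x by rewrite e_sym.
    have zq : z = q.
      apply: (common_three (a := x) _ nup); rewrite // 1?eq_sym //.
      - by rewrite e_sym.
      - by rewrite e_sym.
      - by rewrite eq_sym edge_neq.
    by rewrite zq xq in nxz.
  case: (zero_pair_cover zp xp) => [->|py'|pC|pC]; first by left.
  - by case: (three v); rewrite // py'.
  - have [_ yp _ _] := cross_nonadj zp pC.
    by case: (three y); rewrite // e_sym.
  - have [pv|pv] := eqVneq p v; first by rewrite pv uv in nup.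
    by case: (three v); rewrite // (cliqueP _ cl').
(* [Z] has at least [k - 3] vertices, all adjacent to [v] and outside [D(x)]. Inside [D(x)] there
   are more than [#|C x y'| >= 3] further neighbours of [v]. *)
pose Z := [set z | e u z] :\ x :\ y :\ v.
have subZ : Z :|: C x v \subset [set z | e v z].
  apply/subsetP=> z; rewrite !inE => /orP[/and4P[zv zy zx uz]|/andP[] //].
  have [xz|nxz] := boolP (e x z); last by rewrite to_v // eq_sym.
  by case: (nbrs u v z uC vC uv xz uz) => zE; rewrite zE eqxx in zv zy.
have disZ : [disjoint Z & C x v].
  rewrite -setI_eq0; apply/eqP/setP=> z; rewrite !inE.
  apply/negbTE/negP=> /andP[/and4P[zv zy zx uz] /andP[xz vz]].
  by case: (nbrs u v z uC vC uv xz uz) => zE; rewrite zE eqxx in zv zy.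
have := subset_leq_card subZ; rewrite cardsU disjoint_setI0 // cards0 e_reg.
have := cardsD1 x [set z | e u z]; have := cardsD1 y ([set z | e u z] :\ x).
have := cardsD1 v ([set z | e u z] :\ x :\ y); rewrite -/Z e_reg.
by move: lt_v a3 ab; case: (_ \in _); case: (_ \in _); case: (_ \in _); clear; lia.
Qed.

(** Within [C x y], neither [u] itself nor some [t] is a neighbour of [u]; these two offset the 2 in
    [cross_card]. *)
Lemma nonclique_card_le x y y' u : zero_pair x y y' -> ~~ clique (C x y) ->
  u \in C x y -> #|C x u| <= #|C x y|.
Proof.
move=> zp ncl uC; have [v [vC uv]] := nonclique_cross zp ncl uC.
case: (zp) => xy _ _ _ _; have [t [tC tu nut]] := nonclique_nonnbr xy ncl uC.
apply: leq_trans (cross_card zp uC vC uv) _.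
have sub : [set w in C x y | e u w] \subset C x y :\ u :\ t.
  apply/subsetP=> w; rewrite !in_setD1 inE => /andP[-> uw].
  by rewrite (nonadj_neq uw nut) eq_sym (edge_neq uw).
have := subset_leq_card sub; have := cardsD1 u (C x y).
by have := cardsD1 t (C x y :\ u); rewrite in_setD1 tu tC uC; clear; lia.
Qed.

(* All local degrees are at most [#|C x y| = (k - 2) / 2], and partners add up
   to [k - 2], so they are all equal. *)
Lemma nonclique_pair x y y' s t r : zero_pair x y y' ->
  ~~ clique (C x y) -> ~~ clique (C x y') -> s \in C x y -> t \in C x y ->
  s != t -> ~~ e s t -> r \in C x y -> r = s \/ r = t.
Proof.
move=> zp ncl ncl' sC tC st nst rC; have zp' := zero_pair_sym zp.
have sumk := zero_pair_sum zp.
have ab := cross_card_le zp ncl; have ba := cross_card_le zp' ncl'.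
have [rs|rs] := eqVneq r s; first by left.
have [rt|rt] := eqVneq r t; first by right.
(* If [s'] missed [r] as well as [t'], its degree would be at most [#|C x y| - 1], and no partner
   could make up the difference to [k - 2], which is twice [#|C x y|]. *)
have adj s' t' : s' \in C x y -> t' \in C x y -> s' != t' -> ~~ e s' t' ->
    r != s' -> r != t' -> e s' r.
  move=> sC' tC' st' nst' rs' rt'; apply/negPn/negP=> nsr.
  have [v [vC sv]] := nonclique_cross zp ncl sC'.
  have [xs' _ _ _] := cross_nonadj zp sC'.
  have [xt' _ _ _] := cross_nonadj zp tC'.
  have [||z [xz nxz sz]] := outside_nbr xs' xt'; rewrite 1?eq_sym //.
  have [p [xp _ _ sump]] := partner xz nxz xs' sz.
  have ap : #|C x p| <= #|C x y|.
    case: (zero_pair_cover zp xp) => [->//|->//|pC|pC].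
      exact: (nonclique_card_le zp ncl pC).
    exact: leq_trans (nonclique_card_le zp' ncl' pC) ba.
  have := cross_card zp sC' vC sv.
  have sub : [set w in C x y | e s' w] \subset C x y :\ s' :\ t' :\ r.
    apply/subsetP=> w; rewrite !in_setD1 inE => /andP[-> sw].
    by rewrite (nonadj_neq sw nst') (nonadj_neq sw nsr) eq_sym (edge_neq sw).
  have := subset_leq_card sub; have := cardsD1 s' (C x y).
  have := cardsD1 t' (C x y :\ s'); have := cardsD1 r (C x y :\ s' :\ t').
  rewrite !in_setD1 rs' rt' rC sC' tC' [t' == s']eq_sym st'.
  by move: ap sump sumk ab ba; clear; lia.
move: (sC) (tC) (rC); rewrite !in_common.
move=> /andP[xs ys] /andP[xt yt] /andP[xr yr].
case: zp => xy _ _ _ _.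
have sr : e s r by apply: (adj s t).
have tr : e t r by apply: (adj t s); rewrite // 1?eq_sym // e_sym.
have yr' : y = r by apply: (common_local xs xt st nst); rewrite // e_sym.
by rewrite yr' e_irr in yr.
Qed.

(** By [nonclique_pair] each half has just two vertices, not adjacent to each other, and the edges
    across match them up; adding [y] and [y'] closes a hexagon. *)
Lemma noncliques_hexagonal x y y' : zero_pair x y y' ->
  ~~ clique (C x y) -> ~~ clique (C x y') -> hexagonal x.
Proof.
move=> zp ncl ncl'; have zp' := zero_pair_sym zp.
have [s [t [sC tC st nst]]] := cliquePn ncl.
have [v [vC sv]] := nonclique_cross zp ncl sC.
have [w [wC tw]] := nonclique_cross zp ncl tC.
have [xs ys ny's sy'] := cross_nonadj zp sC.
have [xt yt ny't ty'] := cross_nonadj zp tC.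
have [xv y'v nyv vy] := cross_nonadj zp' vC.
have [xw y'w nyw wy] := cross_nonadj zp' wC.
case: (zp) => xy xy' yy' nyy' zero.
have nsw : ~~ e s w.
  apply/negP=> sw.
  have ys' : y = w.
    by apply: (common_local xs xt st nst); rewrite // e_sym.
  by rewrite ys' eqxx in wy.
have vw : v != w by apply: contraNneq nsw => <-.
have ntv : ~~ e t v.
  apply/negP=> tv; have := cross_unique zp tC vC wC tv tw.
  by move=> vw'; rewrite vw' eqxx in vw.
have all4 u : u \in C x y' -> u = v \/ u = w.
  move=> uC; have [s' [t' [sC' tC' st' nst']]] := cliquePn ncl'.
  have only := nonclique_pair zp' ncl' ncl sC' tC' st' nst'.
  case: (only _ uC) => ->; case: (only _ vC) => vE; case: (only _ wC) => wE;
    rewrite vE wE ?eqxx // in vw *; by [left | right].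
have nvw : ~~ e v w.
  have [s' [t' [sC' tC' st' nst']]] := cliquePn ncl'.
  case: (all4 _ sC') (all4 _ tC') => sE [] tE; move: st' nst';
    rewrite sE tE ?eqxx //.
  by rewrite e_sym.
pose h := [:: y; s; v; y'; w; t]; exists (fun i : 'Z_6 => nth y h i).
have E := (negPf nyv, negPf nyy', negPf nyw, negPf ny's, negPf nsw, negPf nst,
  negPf nvw, negPf ntv, negPf ny't).
have F a b : e a b = false -> e b a = false by rewrite e_sym.
have E' := (F _ _ (negPf nyv), F _ _ (negPf nyy'), F _ _ (negPf nyw),
  F _ _ (negPf ny's), F _ _ (negPf nsw), F _ _ (negPf nst),
  F _ _ (negPf nvw), F _ _ (negPf ntv), F _ _ (negPf ny't)).
have G a b : e a b -> e b a by rewrite e_sym.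
have E2 := (ys, yt, sv, tw, y'v, y'w).
have E2' := (G _ _ ys, G _ _ yt, G _ _ sv, G _ _ tw, G _ _ y'v, G _ _ y'w).
split=> [u|i j].
  split=> [xu|[i ->]].
    have ex n : n < 6 -> nth y h n = u -> exists i : 'Z_6, u = nth y h i.
      by move=> lt_n <-; exists (Ordinal lt_n : 'Z_6).
    case: (zero_pair_cover zp xu) => [uE|uE|uC|uC].
    - exact: (ex 0).
    - exact: (ex 3).
    - case: (nonclique_pair zp ncl ncl' sC tC st nst uC) => uE.
        exact: (ex 1).
      exact: (ex 5).
    - by case: (all4 u uC) => uE; [apply: (ex 2) | apply: (ex 4)].
  by case: i => -[|[|[|[|[|[|]]]]]].
by case: i => -[|[|[|[|[|[|//]]]]]] ?; case: j => -[|[|[|[|[|[|//]]]]]] ?;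
  rewrite /= ?e_irr ?E ?E' ?E2 ?E2'.
Qed.

(** * The local shape and its inheritance along edges *)

Lemma zero_pair_local x y y' : zero_pair x y y' -> bicliqual x \/ hexagonal x.
Proof.
move=> zp; have zp' := zero_pair_sym zp.
have [cl|ncl] := boolP (clique (C x y)); have [cl'|ncl'] := boolP (clique (C x y')).
- by left; apply: two_cliques_bicliqual cl cl'.
- by case: (nonclique_clique zp' ncl' cl).
- by case: (nonclique_clique zp ncl cl').
- by right; apply: noncliques_hexagonal ncl ncl'.
Qed.

(** With [w] the second common neighbour of [y] and [y'], the cycle [x], [y], [w], [y'] is an
    induced quadrangle, and its corner at [y] is the wanted pair. *)
Lemma zero_pair_nbr x y y' : zero_pair x y y' -> exists w, zero_pair y x w.
Proof.
case=> xy xy' yy' nyy' zero.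
have yx : e y x by rewrite e_sym.
have y'x : e y' x by rewrite e_sym.
have [w [wx yw y'w _ _]] := common_other yy' nyy' yx y'x.
have nxw : ~~ e x w by apply/negP => xw; apply: (zero w).
exists w; split; rewrite // 1?eq_sym // => t yt xt wt.
have wy : e w y by rewrite e_sym.
have wy' : e w y' by rewrite e_sym.
rewrite eq_sym in wx.
have y't := common_three wx nxw xy wy xy' wy' xt wt yy' (edge_neq yt).
by rewrite y't yt in nyy'.
Qed.

Lemma bicliqual_trans x u v w : bicliqual x -> e x u -> e x v -> e x w ->
  e u v -> e v w -> u != w -> e u w.
Proof.
case=> S [_ _ eS] xu xv xw uv vw uw; rewrite eS //; move: (uv) (vw).
rewrite eS ?(edge_neq uv) // eS ?(edge_neq vw) //.
by do 3!case: (_ \in S).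
Qed.

Lemma bicliqual_three x u v w : bicliqual x -> e x u -> e x v -> e x w ->
  u != v -> v != w -> u != w -> ~~ e u v -> ~~ e v w -> e u w.
Proof.
case=> S [_ _ eS] xu xv xw uv vw uw.
rewrite (eS u v) // (eS v w) // (eS u w) //.
by do 3!case: (_ \in S).
Qed.

Lemma bicliqual_zero_pair x y : bicliqual x -> e x y ->
  exists y', zero_pair x y y'.
Proof.
move=> bx xy; case: (bx) => S [[s xs sS] [t xt tS] eS].
have [y' [xy' yy' nyy']] : exists y', [/\ e x y', y != y' & ~~ e y y'].
  have [yS|yS] := boolP (y \in S).
    have yt : y != t by apply: contraNneq tS => <-.
    by exists t; split; rewrite // eS // yS (negPf tS).
  have ys : y != s by apply: contraNneq yS => ->.
  by exists s; split; rewrite // eS // sS (negPf yS).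
exists y'; split=> // w xw yw y'w; case/negP: nyy'.
by apply: (bicliqual_trans bx xy xw xy' yw); rewrite // e_sym.
Qed.

(** This is a chordless path with middle vertex [y] in [D(x)]. Two disjoint cliques contain none, so
    it tells the shapes apart. *)
Lemma hexagonal_fork x y : hexagonal x -> e x y ->
  exists s t, [/\ e x s, e x t, e y s, e y t & s != t /\ ~~ e s t].
Proof.
case=> H [imH eH] xy; have [i yi] := (imH y).1 xy.
have xH j : e x (H j) by apply/imH; exists j.
exists (H (i + 1)%R), (H (i - 1)%R); rewrite yi !xH !eH eqxx GRing.subrK eqxx orbT.
split=> //; split; last by case: i {yi} => -[|[|[|[|[|[|//]]]]]] ?.
apply/eqP=> eqH; have := eH (i + 1)%R (i + 2)%R; rewrite eqH eH.
by case: i {yi eqH} => -[|[|[|[|[|[|//]]]]]] ?.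
Qed.

Lemma hexagonal_zero_pair x y : hexagonal x -> e x y ->
  exists y', zero_pair x y y'.
Proof.
case=> H [imH eH] xy; have [i ->] := (imH y).1 xy.
have xH j : e x (H j) by apply/imH; exists j.
exists (H (i + 3)%R); split; rewrite // ?eH.
- apply/eqP=> eqH; have := eH i (i + 2)%R; rewrite eqH eH.
  by case: i {eqH} => -[|[|[|[|[|[|//]]]]]] ?.
- by case: i => -[|[|[|[|[|[|//]]]]]] ?.
move=> w /imH[j ->]; rewrite !eH.
by case: i => -[|[|[|[|[|[|//]]]]]] ?; case: j => -[|[|[|[|[|[|//]]]]]] ?.
Qed.

(** A zero pair passes from [x] to [y], so [y] has one of the two shapes. If it were hexagonal, a
    fork at [y] around [x] would also be a fork at [x] around [y]. *)
Lemma bicliqual_nbr x y : bicliqual x -> e x y -> bicliqual y.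
Proof.
move=> bx xy; have [y' zp] := bicliqual_zero_pair bx xy.
have [w zpy] := zero_pair_nbr zp.
have [//|hy] := zero_pair_local zpy.
have yx : e y x by rewrite e_sym.
have [s [t [ys yt xs xt [st nst]]]] := hexagonal_fork hy yx.
by case/negP: nst; apply: (bicliqual_trans bx xs xy xt); rewrite // e_sym.
Qed.

Lemma hexagonal_nbr x y : hexagonal x -> e x y -> hexagonal y.
Proof.
move=> hx xy; have [y' zp] := hexagonal_zero_pair hx xy.
have [w zpy] := zero_pair_nbr zp.
have [by_|//] := zero_pair_local zpy.
have yx : e y x by rewrite e_sym.
have [s [t [xs xt ys yt [st nst]]]] := hexagonal_fork hx xy.
by case/negP: nst; apply: (bicliqual_trans by_ ys yx yt); rewrite // e_sym.
Qed.

(** Non-adjacent vertices have a common neighbour, so two steps reach every vertex. *)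
Lemma connected_ind (Q : T -> Prop) x :
  (forall u v, Q u -> e u v -> Q v) -> Q x -> forall y, Q y.
Proof.
move=> step Qx y; have [<-//|xy] := eqVneq x y.
have [|nxy] := boolP (e x y); first exact: step.
have : 0 < #|C x y| by rewrite two_common.
case/card_gt0P=> z; rewrite in_common => /andP[xz yz].
by apply: (step z); [apply: step xz | rewrite e_sym].
Qed.

(** * Two cliques at every vertex: the grid *)

Section Grid.

Hypothesis all_bicliqual : forall x, bicliqual x.

Section Line.

Variables (x y : T).
Hypothesis xy : e x y.

(** When all neighbourhoods are two cliques, this is the unique maximal clique containing the edge
    [xy]. *)
Definition line : {set T} := [set z | (z == x) || e x z && ((z == y) || e y z)].

Lemma line_base : x \in line.
Proof. by rewrite inE eqxx. Qed.

Lemma line_dir : y \in line.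
Proof. by rewrite inE xy eqxx orbT. Qed.

Lemma line_clique u v : u \in line -> v \in line -> u != v -> e u v.
Proof.
rewrite !inE => /predU1P[->|/andP[xu yu]] /predU1P[->|/andP[xv yv]] uv.
- by rewrite eqxx in uv.
- by [].
- by rewrite e_sym.
case/predU1P: yu => [uy|yu]; first by case/predU1P: yv uv => [->|]; rewrite uy ?eqxx.
case/predU1P: yv => [->|yv]; first by rewrite e_sym.
by apply: (bicliqual_trans (all_bicliqual x) xu xy xv); rewrite // e_sym.
Qed.

Lemma line_closed_base z p : e x z -> p \in line -> p != x -> e z p -> z \in line.
Proof.
move=> xz; rewrite !inE xz => /predU1P[->|/andP[xp py]]; first by rewrite eqxx.
move=> _ zp; have [|zy] := eqVneq z y; first by rewrite orbT.
case/predU1P: py => [py|yp]; first by rewrite -py e_sym zp !orbT.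
rewrite e_sym in zp; rewrite eq_sym in zy.
by rewrite (bicliqual_trans (all_bicliqual x) xy xp xz yp zp zy) /= orbT.
Qed.

(** Two neighbours of [z] on the line put [z] on it: if neither is [x], transitivity in [D(p)] makes
    [z] equal or adjacent to [x], and [line_closed_base] applies. *)
Lemma line_closed z p q : z \notin line -> p \in line -> q \in line ->
  e z p -> e z q -> p = q.
Proof.
move=> zL pL qL zp zq; apply/eqP; apply: contraNT zL => pq.
have [px|px] := eqVneq p x.
  by apply: (line_closed_base (p := q)); rewrite // -px 1?e_sym // eq_sym.
have [->|zx] := eqVneq z x; first exact: line_base.
have [qx|qx] := eqVneq q x.
  by apply: (line_closed_base (p := p)); rewrite // -qx e_sym.
have xq : e x q by rewrite line_clique ?line_base // eq_sym.
have px' : e p x by rewrite line_clique ?line_base.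
have pz : e p z by rewrite e_sym.
have qx' : e q x by rewrite e_sym.
have zx' := bicliqual_trans (all_bicliqual p) pz (line_clique pL qL pq) px' zq qx' zx.
by apply: (line_closed_base (p := p)); rewrite // e_sym.
Qed.

(** If [z] and [x] are not adjacent and both their common neighbours are off the line, these lie in
    the other clique at [x] and are adjacent; transitivity at one of them would then join [z] to
    [x]. *)
Lemma line_nbr z : z \notin line -> exists2 p, p \in line & e z p.
Proof.
move=> zL; have zx : z != x by apply: contraNneq zL => ->; apply: line_base.
have [zx'|nzx] := boolP (e z x); first by exists x; rewrite ?line_base.
have [y1 y1C] : exists y1, y1 \in C z x.
  by apply/card_gt0P; rewrite two_common.
move: y1C; rewrite in_common => /andP[zy1 xy1].
have [y2 [y21 zy2 xy2 _ _]] := common_other zx nzx zy1 xy1.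
have [y1L|y1L] := boolP (y1 \in line); first by exists y1.
have [y2L|y2L] := boolP (y2 \in line); first by exists y2.
have nadj u : e x u -> u \notin line -> u != y /\ ~~ e y u.
  by rewrite inE negb_or => -> /andP[_]; rewrite negb_or => /andP[].
have [y1y nyy1] := nadj _ xy1 y1L; have [y2y nyy2] := nadj _ xy2 y2L.
have e12 : e y1 y2.
  by apply: (bicliqual_three (all_bicliqual x) xy1 xy xy2); rewrite // 1?eq_sym // e_sym.
case/negP: nzx; apply: (bicliqual_trans (all_bicliqual y1) _ e12); rewrite // e_sym //.
Qed.

Lemma line_outside p u v : p \in line -> u \notin line -> v \notin line ->
  e p u -> e p v -> u != v -> e u v.
Proof.
move=> pL uL vL pu pv uv.
have [q qL pq] : exists2 q, q \in line & p != q.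
  have [->|px] := eqVneq p x; last by exists x; rewrite ?line_base.
  by exists y; rewrite ?line_dir ?edge_neq.
have nadj w : w \notin line -> e p w -> ~~ e w q /\ w != q.
  move=> wL pw; split; last by apply: contraNneq wL => ->.
  apply: contra pq => wq; rewrite e_sym in pw.
  by rewrite (line_closed wL pL qL pw wq).
have [nuq uq] := nadj u uL pu; have [nvq vq] := nadj v vL pv.
apply: (bicliqual_three (all_bicliqual p) pu (line_clique pL qL pq) pv) => //.
  by rewrite eq_sym.
by rewrite e_sym.
Qed.

(** Well defined off the line by [line_nbr] and [line_closed]; the default [x] is never reached. *)
Definition proj z := if z \in line then z else odflt x [pick p in line | e z p].

Lemma proj_id z : z \in line -> proj z = z.
Proof. by rewrite /proj => ->. Qed.

Lemma proj_spec z : z \notin line -> proj z \in line /\ e z (proj z).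
Proof.
move=> zL; rewrite /proj (negPf zL); case: pickP => [p /andP[] //|none].
by have [p pL zp] := line_nbr zL; have := none p; rewrite pL zp.
Qed.

Lemma proj_line z : proj z \in line.
Proof.
have [zL|zL] := boolP (z \in line); first by rewrite proj_id.
by have [] := proj_spec zL.
Qed.

Lemma proj_unique z p : z \notin line -> p \in line -> e z p -> proj z = p.
Proof.
by move=> zL pL zp; have [? ?] := proj_spec zL; apply: (line_closed zL).
Qed.

Lemma proj_fiber u v : proj u = proj v -> u != v -> e u v.
Proof.
move=> eqp uv; have [uL|uL] := boolP (u \in line).
  have [vL|vL] := boolP (v \in line).
    by rewrite -(proj_id uL) eqp proj_id // eqxx in uv.
  by have [_] := proj_spec vL; rewrite -eqp proj_id // e_sym.
have [uLp uu] := proj_spec uL; have [vL|vL] := boolP (v \in line).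
  by rewrite eqp proj_id in uu.
have [_ vv] := proj_spec vL.
apply: (line_outside uLp uL vL); rewrite // e_sym //.
by rewrite eqp.
Qed.

End Line.

Definition axes x y y' := [/\ e x y, e x y', y != y' & ~~ e y y'].

Lemma axes_sym x y y' : axes x y y' -> axes x y' y.
Proof. by case=> *; split; rewrite // 1?eq_sym // e_sym. Qed.

Lemma lines_meet x y y' z : axes x y y' ->
  z \in line x y -> z \in line x y' -> z = x.
Proof.
move=> ax; case: (ax) => xy xy' yy' nyy'.
rewrite !inE => /predU1P[//|/andP[xz yz]] /predU1P[//|/andP[_ y'z]].
case/negP: nyy'; case/predU1P: yz y'z => [->|yz] /predU1P[zy'|y'z].
- by move: yy'; rewrite zy' eqxx.
- by rewrite e_sym.
- by rewrite -zy'.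
by apply: (bicliqual_trans (all_bicliqual x) xy xz xy'); rewrite // e_sym.
Qed.

Lemma lines_cover x y y' z : axes x y y' ->
  e x z -> (z \in line x y) || (z \in line x y').
Proof.
move=> ax; case: (ax) => xy xy' yy' nyy'.
move=> xz; rewrite !inE xz /=; apply: contraR nyy'.
rewrite !negb_or => /andP[/and3P[_ zy nyz] /and3P[_ zy' ny'z]].
apply: (bicliqual_three (all_bicliqual x) xy xz xy') => //.
  by rewrite eq_sym.
by rewrite e_sym.
Qed.

Lemma lines_nonadj x y y' p q : axes x y y' ->
  p \in line x y -> q \in line x y' -> p != x -> q != x ->
  p != q /\ ~~ e p q.
Proof.
move=> ax; case: (ax) => xy xy' yy' nyy'.
move=> pP qQ px qx; split; first by apply: contraNneq px => pq; rewrite (lines_meet ax pP) ?pq.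
apply: contra (qx) => pq; apply/eqP/(lines_meet ax) => //.
have xq : e x q by rewrite (line_clique xy' (line_base x y') qQ) // eq_sym.
by apply: (line_closed_base xy xq pP px); rewrite e_sym.
Qed.

Lemma proj_other x y y' z : axes x y y' ->
  z \in line x y -> proj x y' z = x.
Proof.
move=> ax; case: (ax) => xy xy' yy' nyy'.
move=> zP; have [zQ|zQ] := boolP (z \in line x y').
  by rewrite proj_id //; apply: (lines_meet ax).
have zx : z != x by apply: contraNneq zQ => ->; apply: line_base.
by apply: (proj_unique xy' zQ (line_base x y')); apply: (line_clique xy); rewrite ?line_base.
Qed.

Lemma proj_baseP x y y' u : axes x y y' ->
  proj x y u = x -> u \in line x y'.
Proof.
move=> ax; case: (ax) => xy xy' yy' nyy'.
have [uP|uP] := boolP (u \in line x y).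
  by rewrite (proj_id uP) => ->; apply: line_base.
have [_] := proj_spec xy uP => /[swap] ->; rewrite e_sym.
by move/(lines_cover ax); rewrite (negPf uP).
Qed.

Lemma proj_off x y y' u : axes x y y' ->
  u \notin line x y -> u \notin line x y' ->
  [/\ proj x y u \in line x y, e u (proj x y u) & proj x y u != x].
Proof.
move=> ax; case: (ax) => xy xy' yy' nyy'.
move=> uP uQ; have [? ?] := proj_spec xy uP; split=> //.
by apply: contra uQ => /eqP/(proj_baseP ax).
Qed.

(** Off both lines the two projections are non-adjacent and share [x], so [u] and [v] are both their
    one other common neighbour. On either line one projection is the identity. *)
Lemma proj_inj x y y' u v : axes x y y' ->
  proj x y u = proj x y v -> proj x y' u = proj x y' v -> u = v.
Proof.
move=> ax; have ax' := axes_sym ax; case: (ax) => xy xy' yy' nyy'.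
move=> eqP_ eqQ.
have [px|px] := eqVneq (proj x y u) x.
  have uQ := proj_baseP ax px; rewrite eqP_ in px.
  have vQ := proj_baseP ax px.
  by rewrite -(proj_id uQ) -(proj_id vQ).
have [qx|qx] := eqVneq (proj x y' u) x.
  have uP := proj_baseP ax' qx; rewrite eqQ in qx.
  have vP := proj_baseP ax' qx.
  by rewrite -(proj_id uP) -(proj_id vP).
have off w : proj x y w != x -> proj x y' w != x ->
    [/\ w != x, e w (proj x y w) & e w (proj x y' w)].
  move=> wp wq.
  have wP : w \notin line x y by apply: contra wq => /(proj_other ax)->.
  have wQ : w \notin line x y' by apply: contra wp => /(proj_other ax')->.
  have [_ ? _] := proj_off ax wP wQ.
  have [_ ? _] := proj_off ax' wQ wP.
  by split=> //; apply: contraNneq wP => ->; apply: line_base.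
have [ux up uq] := off u px qx.
have := off v; rewrite -eqP_ -eqQ => /(_ px qx)[vx vp vq].
have [pq npq] := lines_nonadj ax (proj_line xy u) (proj_line xy' u) px qx.
have xp : e (proj x y u) x by rewrite (line_clique xy) ?proj_line ?line_base.
have xq : e (proj x y' u) x by rewrite (line_clique xy') ?proj_line ?line_base.
rewrite e_sym in up; rewrite e_sym in uq; rewrite e_sym in vp; rewrite e_sym in vq.
by rewrite eq_sym in ux; rewrite eq_sym in vx; apply: (common_three pq npq xp xq up uq vp vq).
Qed.

(** If neither [p] nor [q] is [x], the vertex is their common neighbour other than [x]. *)
Lemma proj_surj x y y' p q : axes x y y' ->
  p \in line x y -> q \in line x y' ->
  exists2 z, proj x y z = p & proj x y' z = q.
Proof.
move=> ax; have ax' := axes_sym ax; case: (ax) => xy xy' yy' nyy'.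
move=> pP qQ; have [->|px] := eqVneq p x.
  by exists q; rewrite ?(proj_id qQ) // (proj_other ax').
have [->|qx] := eqVneq q x.
  by exists p; rewrite ?(proj_id pP) // (proj_other ax).
have [pq npq] := lines_nonadj ax pP qQ px qx.
have xp : e p x by rewrite (line_clique xy) ?line_base.
have xq : e q x by rewrite (line_clique xy') ?line_base.
have [z [zx pz qz _ _]] := common_other pq npq xp xq.
have zP : z \notin line x y.
  apply: contra zx => zP; apply/eqP.
  have qP : q \notin line x y.
    by apply: contra qx => qP; rewrite (lines_meet ax qP qQ).
  exact: (line_closed xy qP zP (line_base _ _)).
have zQ : z \notin line x y'.
  apply: contra zx => zQ; apply/eqP.
  have pQ : p \notin line x y'.
    by apply: contra px => pQ; rewrite (lines_meet ax pP pQ).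
  exact: (line_closed xy' pQ zQ (line_base _ _)).
by exists z; apply: proj_unique; rewrite // e_sym.
Qed.

Lemma proj_edge_line x y y' u v : axes x y y' ->
  u \in line x y -> e u v ->
  proj x y u = proj x y v \/ proj x y' u = proj x y' v.
Proof.
move=> ax; case: (ax) => xy xy' yy' nyy'.
move=> uP uv; have [vP|vP] := boolP (v \in line x y).
  by right; rewrite !(proj_other ax).
by left; rewrite (proj_id uP) (proj_unique xy vP uP) // e_sym.
Qed.

Lemma proj_edge x y y' u v : axes x y y' -> e u v ->
  proj x y u = proj x y v \/ proj x y' u = proj x y' v.
Proof.
move=> ax; have ax' := axes_sym ax; case: (ax) => xy xy' yy' nyy'.
move=> uv; have vu : e v u by rewrite e_sym.
have [uP|uP] := boolP (u \in line x y).
  exact: (proj_edge_line ax uP).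
have [vP|vP] := boolP (v \in line x y).
  by case: (proj_edge_line ax vP vu) => ->; [left | right].
have [uQ|uQ] := boolP (u \in line x y').
  by case: (proj_edge_line ax' uQ uv) => ->; [right | left].
have [vQ|vQ] := boolP (v \in line x y').
  by case: (proj_edge_line ax' vQ vu) => ->; [right | left].
have [pP up px] := proj_off ax uP uQ.
have [p'P vp' p'x] := proj_off ax vP vQ.
have [q'Q vq' q'x] := proj_off ax' vQ vP.
have [|pp'] := eqVneq (proj x y u) (proj x y v); first by left.
have [|qq'] := eqVneq (proj x y' u) (proj x y' v); first by right.
(* [w] takes one coordinate from [u] and the other from [v]. The non-adjacent vertices [proj x y u]
   and [v] then share [u], [w] and [proj x y v], which forces [w] onto the line. *)
have [w wp wq] := proj_surj ax pP q'Q.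
have wP : w \notin line x y.
  by apply: contra q'x => wP; rewrite -wq (proj_other ax).
have [_ pw] := proj_spec xy wP; rewrite wp e_sym in pw.
have pv : proj x y u != v by apply: contraNneq vP => <-.
have npv : ~~ e (proj x y u) v.
  apply: contra pp' => pv'; rewrite e_sym in pv'.
  by rewrite (proj_unique xy vP pP pv').
have vw : e v w.
  by apply: (proj_fiber xy'); [rewrite wq | rewrite eq_sym (nonadj_neq pw npv)].
have p'w : proj x y v = w.
  apply: (common_three (a := u) pv npv) => //.
  - by rewrite e_sym.
  - exact: (line_clique xy).
  - by apply: contraNneq uP => ->.
  - by apply: contraNneq qq' => ->; rewrite wq.
by rewrite -p'w p'P in wP.
Qed.

Lemma bicliqual_grid x y y' : axes x y y' ->
  #|line x y| + #|line x y'| = k + 2 /\ graph_iso e (@grid #|line x y| #|line x y'|).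
Proof.
move=> ax; case: (ax) => xy xy' yy' nyy'.
(* The two lines cover [x] and its neighbours and meet only in [x], so their sizes add up to
   [(k + 1) + 1]. *)
have UPQ : line x y :|: line x y' = x |: [set z | e x z].
  apply/setP=> z; rewrite in_setU in_setU1 [X in _ = _ || X]inE.
  apply/orP/predU1P => [|[->|xz]]; last exact/orP/(lines_cover ax).
    by case; rewrite inE => /predU1P[->|/andP[? _]]; by [left | right].
  by left; apply: line_base.
have IPQ : line x y :&: line x y' = [set x].
  apply/setP=> z; rewrite in_setI in_set1; apply/andP/eqP=> [[]|->].
    exact: (lines_meet ax).
  by rewrite !line_base.
split.
  by rewrite -cardsUI UPQ IPQ cards1 cardsU1 inE e_irr e_reg; clear; lia.
pose h z := (enum_rank_in (line_base x y) (proj x y z),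
             enum_rank_in (line_base x y') (proj x y' z)).
have h1 u v : ((h u).1 == (h v).1) = (proj x y u == proj x y v).
  rewrite /h /=; apply/eqP/eqP=> [eq_r|-> //].
  by apply: (enum_rank_in_inj _ _ eq_r); apply: proj_line.
have h2 u v : ((h u).2 == (h v).2) = (proj x y' u == proj x y' v).
  rewrite /h /=; apply/eqP/eqP=> [eq_r|-> //].
  by apply: (enum_rank_in_inj _ _ eq_r); apply: proj_line.
exists h.
  apply: inj_surj_bij => [u v huv|[i j]].
    apply: (proj_inj ax); apply/eqP.
      by rewrite -h1 huv.
    by rewrite -h2 huv.
  have [z zi zj] := proj_surj ax (enum_valP i) (enum_valP j).
  by exists z; rewrite /h zi zj !enum_valK_in.
move=> u v; rewrite /grid /cartesian_product /complete_rel /= h1 h2.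
have [eq1|ne1] := eqVneq (proj x y u) (proj x y v);
  have [eq2|ne2] := eqVneq (proj x y' u) (proj x y' v) => /=.
- by rewrite (proj_inj ax eq1 eq2) e_irr.
- by rewrite (proj_fiber xy eq1) //; apply: contraNneq ne2 => ->.
- by rewrite (proj_fiber xy' eq2) //; apply: contraNneq ne1 => ->.
- apply/esym/negbTE/negP=> /(proj_edge ax)[] E; first by rewrite E eqxx in ne1.
  by rewrite E eqxx in ne2.
Qed.

End Grid.

(** * Hexagons at every vertex: the Shrikhande graph *)

Section Shrikhande.

Hypothesis all_hexagonal : forall x, hexagonal x.

(** Distinct vertices of a hexagon have distinct neighbourhoods. *)
Lemma hexagon_inj (H : 'Z_6 -> T) :
  (forall i j, e (H i) (H j) = (j == i + 1)%R || (i == j + 1)%R) ->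
  injective H.
Proof.
move=> eH i j eqH.
have A l : (l == i + 1)%R || (i == l + 1)%R = (l == j + 1)%R || (j == l + 1)%R.
  by rewrite -!eH eqH.
have := A (i + 1)%R; have := A (i + 5)%R.
by case: i {A eqH} => -[|[|[|[|[|[|//]]]]]] ?;
  case: j => -[|[|[|[|[|[|//]]]]]] ? //= _ _; apply/val_inj.
Qed.

Lemma hexagonal_degree : T -> k = 6.
Proof.
move=> x; have [H [imH eH]] := all_hexagonal x.
rewrite -(e_reg x) -[RHS](card_ord 6) -cardsT -(card_imset _ (hexagon_inj eH)).
congr #|pred_of_set _|; apply/setP=> y; rewrite inE; apply/idP/imsetP.
  by move/imH=> [i ->]; exists i.
by case=> i _ ->; apply/imH; exists i.
Qed.

(** An adjacent pair also has two common neighbours, the neighbours of [y] on the rim around [x].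
    Counting arguments now apply to all pairs. *)
Lemma hexagonal_common x y : x != y -> #|C x y| = 2.
Proof.
move=> xy; have [exy|] := boolP (e x y); last exact: two_common.
have [H [imH eH]] := all_hexagonal x; have [i yi] := (imH y).1 exy.
have -> : C x y = [set H (i + 1)%R; H (i - 1)%R].
  apply/setP=> z; rewrite in_common in_set2 yi.
  apply/andP/orP=> [[/imH[j ->]]|[] /eqP->]; rewrite eH.
  - case/orP=> /eqP->; rewrite ?GRing.addrK; [by left | by right].
  - by rewrite eqxx; split=> //; apply/imH; exists (i + 1)%R.
  - by rewrite GRing.subrK eqxx orbT; split=> //; apply/imH; exists (i - 1)%R.
rewrite cards2; case: eqP => // /(hexagon_inj eH).
by case: i {yi} => -[|[|[|[|[|[|//]]]]]] ?.
Qed.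

Lemma hexagonal_three x z a b c : x != z -> e x a -> e z a ->
  e x b -> e z b -> e x c -> e z c -> a != b -> a != c -> b = c.
Proof.
move=> xz xa za xb zb xc zc ab ac; apply/eqP/negPn/negP=> bc.
have sub : [set a; b; c] \subset C x z.
  apply/subsetP=> w; rewrite !inE => /orP[/orP[]|] /eqP->.
  - by rewrite xa.
  - by rewrite xb.
  - by rewrite xc.
have := subset_leq_card sub; rewrite (hexagonal_common xz) -setUA.
by rewrite !cardsU1 cards1 !inE (negPf ab) (negPf ac) (negPf bc).
Qed.

(** * Adjacencies determined by one wheel *)

Section Wheel.

Variables (x : T) (H : 'Z_6 -> T).
Hypothesis imH : forall y, e x y <-> exists i, y = H i.
Hypothesis eH : forall i j, e (H i) (H j) = (j == i + 1)%R || (i == j + 1)%R.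

Lemma rim_hub i : e x (H i).
Proof. by apply/imH; exists i. Qed.

Lemma eq_rim i j : (H i == H j) = (i == j).
Proof. by apply/eqP/eqP=> [/(hexagon_inj eH)|->]. Qed.

(** The second common neighbour, after the hub, of two rim vertices: tips for [d = 1], poles for
    [d = 3]. The default is never reached when [d] is nonzero. *)
Definition apex (d i : 'Z_6) : T :=
  odflt x [pick z | [&& e (H i) z, e (H (i + d)%R) z & z != x]].

Lemma apex_spec d i : d != 0%R ->
  [/\ e (H i) (apex d i), e (H (i + d)%R) (apex d i) & apex d i != x].
Proof.
move=> d0; rewrite /apex; case: pickP => [z /and3P[] //|none].
have ne : H i != H (i + d)%R by rewrite eq_rim -subr_eq0 opprD addNKr oppr_eq0.
have := hexagonal_common ne; rewrite (cardsD1 x) in_common ![e (H _) x]e_sym !rim_hub.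
rewrite add1n => -[c1]; have /card_gt0P[z] : 0 < #|C (H i) (H (i + d)%R) :\ x| by rewrite c1.
by rewrite in_setD1 in_common => /and3P[zx iz jz]; have := none z; rewrite iz jz zx.
Qed.

Lemma apex_unique d i z : d != 0%R -> e (H i) z -> e (H (i + d)%R) z ->
  z != x -> z = apex d i.
Proof.
move=> d0 iz jz zx; have [ia ja ax] := apex_spec i d0.
have ne : H i != H (i + d)%R by rewrite eq_rim -subr_eq0 opprD addNKr oppr_eq0.
by apply: (hexagonal_three (a := x) ne); rewrite // 1?eq_sym // e_sym rim_hub.
Qed.

Local Notation U := (apex 1%R).
Local Notation W := (apex 3%R).

(** On a hexagon neither consecutive nor opposite vertices have a common neighbour, so the apex is
    not on the rim. *)
Lemma apex_far d i : (d == 1)%R || (d == 3)%R -> ~~ e x (apex d i).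
Proof.
move=> d13; have [|ia ja ax] := @apex_spec d i; first by case/orP: d13 => /eqP->.
apply/negP=> /imH[j aj]; rewrite aj !eH in ia ja.
move: ia ja; case/orP: d13 => /eqP->; case: i {aj ax} => -[|[|[|[|[|[|//]]]]]] ?;
  by case: j => -[|[|[|[|[|[|//]]]]]] ?.
Qed.

(** The apex is not adjacent to the hub, so [H i] and [H (i + d)] exhaust their common
    neighbours. *)
Lemma rim_apex d i j : (d == 1)%R || (d == 3)%R ->
  e (H j) (apex d i) = (j == i) || (j == i + d)%R.
Proof.
move=> d13; have d0 : d != 0%R by case/orP: d13 => /eqP->.
have [ia ja ax] := apex_spec i d0; have nxa := apex_far i d13.
apply/idP/orP=> [ha|[] /eqP-> //].
have [|ij] := eqVneq j i; first by left.
right; rewrite -eq_rim; apply/eqP.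
apply: (common_three (x := x) (z := apex d i) (a := H i)); rewrite ?rim_hub //.
- by rewrite eq_sym.
- by rewrite e_sym.
- by rewrite e_sym.
- by rewrite e_sym.
- by rewrite eq_rim eq_sym.
- by rewrite eq_rim -subr_eq0 opprD addNKr oppr_eq0.
Qed.

Lemma rimU i j : e (H j) (U i) = (j == i) || (j == i + 1)%R.
Proof. exact: rim_apex. Qed.

Lemma rimW i j : e (H j) (W i) = (j == i) || (j == i + 3)%R.
Proof. exact: rim_apex. Qed.

Lemma apexW3 i : W (i + 3)%R = W i.
Proof.
apply: apex_unique => //; rewrite ?rimW.
- by clear; case: i => -[|[|[|[|[|[|//]]]]]] ?.
- by rewrite eqxx.
- by have [] := @apex_spec 3%R (i + 3)%R.
Qed.

(** [z] has a second rim neighbour [H j]. If [j] were [i + 2] or [i - 2], then [H i] and [H j] would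
    share the hub, [z] and the rim vertex between them. *)
Lemma far_cases z i : z != x -> ~~ e x z -> e (H i) z ->
  [\/ z = U i, z = U (i - 1)%R | z = W i].
Proof.
move=> zx nxz iz; rewrite eq_sym in zx.
have zi : e z (H i) by rewrite e_sym.
have [y [yi /imH[j yj] zy _ _]] := common_other zx nxz (rim_hub i) zi.
rewrite yj eq_rim e_sym in yi zy; rewrite eq_sym in zx.
have no2 l : e (H i) (H l) -> e (H j) (H l) -> False.
  move=> il jl; have zl : z = H l.
    have ij : H i != H j by rewrite eq_rim eq_sym.
    apply: (hexagonal_three (a := x) ij); rewrite // 1?e_sym ?rim_hub //.
      by rewrite eq_sym.
    by rewrite edge_neq ?rim_hub.
  by rewrite zl rim_hub in nxz.
have [ji|j1] := eqVneq j (i + 1)%R.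
  by apply: Or31; apply: apex_unique; rewrite // -ji.
have [ji|j5] := eqVneq j (i - 1)%R.
  by apply: Or32; apply: apex_unique; rewrite // ?subrK // -ji.
have [ji|j3] := eqVneq j (i + 3)%R.
  by apply: Or33; apply: apex_unique; rewrite // -ji.
exfalso; have := no2 (i + 1)%R; have := no2 (i - 1)%R; rewrite !eH.
move: yi j1 j5 j3; clear; case: i => -[|[|[|[|[|[|//]]]]]] ?;
  by case: j => -[|[|[|[|[|[|//]]]]]] ? //= _ _ _ _ h1 h2;
  by [case: (h1 isT isT) | case: (h2 isT isT)].
Qed.

Lemma Z6_cases (i j : 'Z_6) :
  [|| j == i, j == i + 1, j == i + 2, j == i + 3, j == i + 4 | j == i - 1]%R.
Proof.
by case: i => -[|[|[|[|[|[|//]]]]]] ?; case: j => -[|[|[|[|[|[|//]]]]]] ?.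
Qed.

Lemma rim_neq_apex d i j : (d == 1)%R || (d == 3)%R -> H j != apex d i.
Proof. by move=> d13; apply: nonadj_neq (rim_hub j) (apex_far i d13). Qed.

Lemma eqU i j : (U i == U j) = (i == j).
Proof.
apply/eqP/eqP=> [eqU|-> //]; have A l := rimU i l.
have := A i; have := A (i + 1)%R; rewrite eqU !rimU.
by case: i {A eqU} => -[|[|[|[|[|[|//]]]]]] ?;
  case: j => -[|[|[|[|[|[|//]]]]]] ? //= _ _; apply/val_inj.
Qed.

Lemma neqUW i j : U i != W j.
Proof.
apply/eqP=> eqUW; have A l := rimU i l.
have := A j; have := A (j + 3)%R; rewrite eqUW !rimW.
by case: i {A eqUW} => -[|[|[|[|[|[|//]]]]]] ?; case: j => -[|[|[|[|[|[|//]]]]]] ?.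
Qed.

(** By [far_cases] only these two tips can be common neighbours of [H i] and [W i], and there must
    be two. *)
Lemma apexWU i : e (W i) (U i) /\ e (W i) (U (i - 1)%R).
Proof.
have HW : H i != W i by apply: rim_neq_apex.
have sub : C (H i) (W i) \subset [set U i; U (i - 1)%R].
  apply/subsetP=> z; rewrite in_common in_set2 => /andP[iz wz].
  have zx : z != x.
    by apply: contraTneq wz => ->; rewrite e_sym; apply: apex_far.
  have nxz : ~~ e x z.
    apply/negP=> /imH[j zj]; move: iz wz; rewrite zj [e (W i) _]e_sym eH rimW.
    by case: i {HW} => -[|[|[|[|[|[|//]]]]]] ?; case: j {zj} => -[|[|[|[|[|[|//]]]]]] ?.
  case: (far_cases zx nxz iz) => zE; rewrite zE ?eqxx ?orbT //.
  by rewrite zE e_irr in wz.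
have /eqP eqC : C (H i) (W i) == [set U i; U (i - 1)%R].
  by rewrite eqEcard sub hexagonal_common // cards2; case: (_ != _).
have : U i \in C (H i) (W i) by rewrite eqC in_set2 eqxx.
have : U (i - 1)%R \in C (H i) (W i) by rewrite eqC in_set2 eqxx orbT.
by rewrite !in_common => /andP[_ ->] /andP[_ ->].
Qed.

(** This is [apexWU] at both names of the pole, [i] and [i + 3]. *)
Lemma apexWU_all i j : [|| j == i, j == i - 1, j == i + 3 | j == i + 2]%R ->
  e (W i) (U j).
Proof.
case/or4P=> /eqP->; try by have [] := apexWU i.
  by rewrite -apexW3; have [] := apexWU (i + 3)%R.
rewrite -apexW3; have [_] := apexWU (i + 3)%R.
by congr (e _ (U _)); rewrite -addrA; congr (_ + _)%R; apply/val_inj.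
Qed.

(** Such an edge would give [H i] and [U i] three common neighbours: [H (i + 1)], [W i] and
    [U (i - 1)]. *)
Lemma apexUU1 i : ~~ e (U i) (U (i - 1)%R).
Proof.
apply/negP=> uu; have HU : H i != U i by apply: rim_neq_apex.
have [wu wu1] := apexWU i.
have WU : W i = U (i - 1)%R.
  apply: (hexagonal_three (a := H (i + 1)%R) HU) => //.
  - by rewrite eH eqxx.
  - by rewrite e_sym rimU eqxx orbT.
  - by rewrite rimW eqxx.
  - by rewrite e_sym.
  - by rewrite rimU subrK eqxx orbT.
  - exact: rim_neq_apex.
  - exact: rim_neq_apex.
by have := neqUW (i - 1)%R i; rewrite -WU eqxx.
Qed.

Lemma degree_list a (s : seq T) z :
  uniq s -> size s = 6 -> all (e a) s -> e a z -> z \in s.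
Proof.
move=> us ss /allP als az.
have sub : [set w in s] \subset [set w | e a w].
  by apply/subsetP=> w; rewrite !inE; apply: als.
have /eqP eqs : [set w in s] == [set w | e a w].
  by rewrite eqEcard sub e_reg cardsE (card_uniqP us) ss (hexagonal_degree a).
have : z \in [set w | e a w] by rewrite inE.
by rewrite -eqs inE.
Qed.

Lemma apexW_nbrs i z : e (W i) z ->
  z \in [:: H i; H (i + 3)%R; U i; U (i - 1)%R; U (i + 3)%R; U (i + 2)%R].
Proof.
apply: degree_list => //=.
  rewrite !inE !eq_rim !eqU !(negPf (rim_neq_apex _ _ _)) //=.
  by case: i => -[|[|[|[|[|[|//]]]]]] ?.
rewrite ![e (W i) (H _)]e_sym !rimW !apexWU_all ?eqxx ?orbT //.
Qed.

(** Without this edge, [U i] has only the five possible neighbours listed in [s], against degree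
    six. *)
Lemma apexUU2 i : e (U i) (U (i + 2)%R).
Proof.
apply/negPn/negP=> n2.
have UW j : U i != W j by apply: neqUW.
(* [U i] and [W i] share one vertex besides [H i]; among the neighbours of [W i] only [U (i + 3)] is
   left. *)
have e3 : e (U i) (U (i + 3)%R).
  have : 0 < #|C (U i) (W i) :\ H i|.
    have := hexagonal_common (UW i); rewrite (cardsD1 (H i)) in_common.
    by rewrite ![e _ (H i)]e_sym rimU rimW eqxx /= add1n => -[->].
  case/card_gt0P=> z; rewrite in_setD1 in_common => /and3P[zH uz wz].
  have := apexW_nbrs wz; rewrite !inE (negPf zH) /=.
  case/or4P=> [/eqP zE|/eqP zE|/eqP zE|/orP[]/eqP zE]; rewrite zE in uz => //.
  - by move: uz; rewrite e_sym rimU; clear; case: i => -[|[|[|[|[|[|//]]]]]] ?.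
  - by rewrite e_irr in uz.
  - by have := apexUU1 i; rewrite uz.
  - by rewrite uz in n2.
(* Otherwise [U i] and [W (i + 1)] would share [H (i + 1)], [U (i + 3)] and [U (i + 4)]. *)
have n4 : ~~ e (U i) (U (i + 4)%R).
  apply/negP=> e4; have eq34 : U (i + 3)%R = U (i + 4)%R.
    apply: (hexagonal_three (a := H (i + 1)%R) (UW (i + 1)%R)) => //.
    - by rewrite e_sym rimU eqxx orbT.
    - by rewrite e_sym rimW eqxx.
    - by apply: apexWU_all; clear; case: i => -[|[|[|[|[|[|//]]]]]] ?.
    - by apply: apexWU_all; clear; case: i => -[|[|[|[|[|[|//]]]]]] ?.
    - exact: rim_neq_apex.
    - exact: rim_neq_apex.
  move/eqP: eq34; rewrite eqU; clear; by case: i => -[|[|[|[|[|[|//]]]]]] ?.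
pose s := [:: H i; H (i + 1)%R; W i; W (i + 1)%R; U (i + 3)%R].
have Wi j : e (U i) (W j) -> W j \in s.
  move=> uw; rewrite !inE; case/or4P: (Z6_cases i j) => [|||/or3P[]] /eqP jE.
  - by rewrite jE eqxx !orbT.
  - by rewrite jE eqxx !orbT.
  - exfalso; rewrite e_sym in uw; have := apexW_nbrs uw.
    rewrite !inE ![U i == H _]eq_sym !(negPf (rim_neq_apex _ _ _)) //= !eqU jE.
    by clear; case: i => -[|[|[|[|[|[|//]]]]]] ?.
  - by rewrite jE apexW3 eqxx !orbT.
  - have -> : j = (i + 1 + 3)%R.
      by rewrite jE; clear; case: i => -[|[|[|[|[|[|//]]]]]] ?; apply/val_inj.
    by rewrite apexW3 eqxx !orbT.
  - exfalso; rewrite e_sym in uw; have := apexW_nbrs uw.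
    rewrite !inE ![U i == H _]eq_sym !(negPf (rim_neq_apex _ _ _)) //= !eqU jE.
    by clear; case: i => -[|[|[|[|[|[|//]]]]]] ?.
have Ui j : e (U i) (U j) -> U j \in s.
  move=> uu; rewrite !inE; case/or4P: (Z6_cases i j) uu => [|||/or3P[]] /eqP-> uu.
  - by rewrite e_irr in uu.
  - by have := apexUU1 (i + 1)%R; rewrite addrK e_sym uu.
  - by rewrite uu in n2.
  - by rewrite eqxx !orbT.
  - by rewrite uu in n4.
  - by have := apexUU1 i; rewrite uu.
have sub : [set z | e (U i) z] \subset [set z in s].
  apply/subsetP=> z; rewrite in_set [z \in [set z in s]]in_set => uz.
  have zx : z != x.
    by apply: contraTneq uz => ->; rewrite e_sym; apply: apex_far.
  have [/imH[j zj]|nxz] := boolP (e x z).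
    move: uz; rewrite zj e_sym rimU !inE !eq_rim.
    by case/orP=> ->; rewrite ?orbT.
  have : 0 < #|C x z| by rewrite two_common // eq_sym.
  case/card_gt0P=> w; rewrite in_common => /andP[/imH[j wj]].
  rewrite wj e_sym => jz.
  case: (far_cases zx nxz jz) => zE; rewrite zE in uz *.
  - exact: Ui.
  - exact: Ui.
  - exact: Wi.
have := subset_leq_card sub; rewrite e_reg (hexagonal_degree x) cardsE.
by move/leq_trans/(_ (card_size _)).
Qed.

Lemma apexUU i j : (j == i + 2)%R || (i == j + 2)%R -> e (U i) (U j).
Proof.
case/orP=> /eqP->; first exact: apexUU2.
by rewrite e_sym; apply: apexUU2.
Qed.

Definition vertex (c : spot) : T :=
  match c with
  | Hub => x
  | Rim i => H i
  | Tip i => U i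
  | Pole i => W i
  end.

Lemma spot_adj_edge c d : spot_adj c d -> e (vertex c) (vertex d).
Proof.
have HU i j := rimU j i; have HW i j := rimW j i.
case: c d => [|i|i|i] [|j|j|j] //=.
- by rewrite rim_hub.
- by rewrite e_sym rim_hub.
- by rewrite eH.
- by rewrite HU.
- by rewrite HW.
- by rewrite e_sym HU.
- exact: apexUU.
- by rewrite e_sym; apply: apexWU_all.
- by rewrite e_sym HW.
- exact: apexWU_all.
Qed.

(** The right-hand side depends only on the vertex, so spots naming the same vertex have equal
    fingerprints; with [spot_sig_inj], the map from the Shrikhande graph is injective. *)
Lemma spot_sig_vertex c : spot_sig c =
  e x (vertex c) :: [seq e (H i) (vertex c) | i <- [:: 0; 1; 2; 3; 4; 5]%R].
Proof.
case: c => [|i|i|i]; rewrite /spot_sig /=.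
- by rewrite e_irr ![e _ x]e_sym !rim_hub.
- by rewrite rim_hub !eH.
- by rewrite (negPf (apex_far _ _)) // !rimU.
- by rewrite (negPf (apex_far _ _)) // !rimW.
Qed.

Lemma spot_vertex_surj z : exists a, vertex (spot_of a) = z.
Proof.
have onH i : exists a, vertex (spot_of a) = H i.
  by have [a aE] := spot_of_rim i; exists a; rewrite aE.
have onU i : exists a, vertex (spot_of a) = U i.
  by have [a aE] := spot_of_tip i; exists a; rewrite aE.
have onW i : exists a, vertex (spot_of a) = W i.
  have [a [aE|aE]] := spot_of_pole i; exists a; rewrite aE //=.
  by rewrite apexW3.
have [->|zx] := eqVneq z x; first by exists (0, 0)%R.
have [/imH[i ->]|nxz] := boolP (e x z); first exact: onH.
have : 0 < #|C x z| by rewrite two_common // eq_sym.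
case/card_gt0P=> w; rewrite in_common => /andP[/imH[j wj]].
rewrite wj e_sym => jz; case: (far_cases zx nxz jz) => ->.
- exact: onU.
- exact: onU.
- exact: onW.
Qed.

Lemma wheel_shrikhande : graph_iso e shrikhande.
Proof.
pose g a := vertex (spot_of a).
have g_inj : injective g.
  by move=> a b gab; apply: spot_sig_inj; rewrite !spot_sig_vertex -/(g a) gab.
have g_hom a b : shrikhande a b -> e (g a) (g b).
  by move/spot_of_adj/spot_adj_edge.
have g_iso a b : e (g a) (g b) = shrikhande a b.
  apply/idP/idP => [ab|]; last exact: g_hom.
  have sub : g @: [set c | shrikhande a c] \subset [set z | e (g a) z].
    by apply/subsetP=> z /imsetP[c]; rewrite !inE => ac ->; apply: g_hom.
  have /eqP eqN : g @: [set c | shrikhande a c] == [set z | e (g a) z].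
    rewrite eqEcard sub e_reg (card_imset _ g_inj) shrikhande_degree.
    by rewrite (hexagonal_degree x).
  have : g b \in [set z | e (g a) z] by rewrite inE.
  by rewrite -eqN => /imsetP[c]; rewrite inE => ac /g_inj->.
have [f gK fK] : bijective g.
  apply: inj_surj_bij => // z.
  by have [a aE] := spot_vertex_surj z; exists a; rewrite /g aE.
exists f; first by exists g.
by move=> u v; rewrite -g_iso !fK.
Qed.

End Wheel.

Lemma hexagonal_shrikhande : T -> graph_iso e shrikhande.
Proof.
by move=> x; have [H [imH eH]] := all_hexagonal x; apply: (wheel_shrikhande imH eH).
Qed.

End Shrikhande.

(** * From a quadrangle to the classification *)

Lemma quadrangle_zero_pair :
  has_induced_quadrangle e -> exists x y y', zero_pair x y y'.
Proof.
case=> x0 [x1 [x2 [x3 [/= /and4P[]]]]]; rewrite !inE !negb_or.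
move=> /and3P[_ x02 _] /andP[_ x13] _ _ [e01 e12 e23 e30] n02 n13.
(* [x1] and [x3] are the only common neighbours of [x0] and [x2], and neither is adjacent to
   [x1]. *)
exists x1, x0, x2; split=> //; first by rewrite e_sym.
move=> w e1w e0w e2w; rewrite e_sym in e12; rewrite e_sym in e30.
have x3w := common_three x02 n02 e01 e12 e30 e23 e0w e2w x13 (edge_neq e1w).
by rewrite x3w e1w in n13.
Qed.

Lemma quadrangle_classification : has_induced_quadrangle e ->
  graph_iso e shrikhande \/
  exists p q : nat, p + q = k + 2 /\ graph_iso e (@grid p q).
Proof.
move/quadrangle_zero_pair=> [x [y [y' zp]]].
have [bx|hx] := zero_pair_local zp; last first.
  by left; apply: (hexagonal_shrikhande (connected_ind hexagonal_nbr hx) x).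
right; exists #|line x y|, #|line x y'|.
apply: (bicliqual_grid (connected_ind bicliqual_nbr bx)).
by case: zp => xy xy' yy' nyy' _; split.
Qed.

End Local.

Theorem theorem4p1 (T : finType) (e : rel T) (n k : nat)
  (e_simple : simple_graph e)
  (e_walk : walk_regular e)
  (e_scer : strongly_co_edge_regular e n k 2 (k - 2))
  (e_quad : has_induced_quadrangle e) :
  graph_iso e shrikhande \/
  exists p q : nat, p + q = k + 2 /\ graph_iso e (@grid p q).
Proof.
case: e_simple => e_sym e_irr; case: e_scer => -[_ e_reg _ _ two] sum2.
exact: (quadrangle_classification e_sym e_irr e_reg two sum2 e_quad).
Qed.
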